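(* Let $N\subseteq M$ be a strongly Markov inclusion of finite-dimensional von Neumann algebras, with trace $\tau$ on $M$, which admits an orthonormal Pimsner--Popa basis $\{u_i\}$ for $M$ over $N$ in $\mathcal{N}_M(N)$. Then $$\chi_{loc}(M,N',\mathcal{B}(L^2(M,\tau)))=\chi_q(M,N',\mathcal{B}(L^2(M,\tau)))=\chi_{qc}(M,N',\mathcal{B}(L^2(M,\tau)))=[M:N].$$
   Context: Inclusions are unital. $(M,\tau)$ is tracial: $\tau$ is a faithful (normal) tracial state. $M$ acts on the GNS space $L^2(M,\tau)$ by left multiplication, $\Lambda_\tau:M\to L^2(M,\tau)$ is the GNS map, $e_N$ is the orthogonal projection onto $\overline{\Lambda_\tau(N)}$, $E_N:M\to N$ is the $\tau$-preserving conditional expectation, and $N'$ is the commutant of $N$ in $\mathcal{B}(L^2(M,\tau))$. A (left) Pimsner--Popa basis for $M$ over $N$ is a finite subset $\{\lambda_i\}\subseteq M$ with $\sum_i\lambda_i^*e_N\lambda_i=1$; it is orthonormal if $E_N(\lambda_i\lambda_j^* )=\delta_{i,j}1$. With $M_1=\langle M,e_N\rangle$ and its canonical trace $\mathrm{tr}_1$ determined by $\mathrm{tr}_1(xe_Ny)=\tau(xy)$ ($x,y\in M$), $\tau$ is Markov for $N\subseteq M$ if $\mathrm{tr}_1$ is finite and $\mathrm{tr}_1(1)^{-1}\mathrm{tr}_1$ restricts to $\tau$ on $M$. The inclusion is strongly Markov if $\tau$ is Markov and a finite Pimsner--Popa basis exists; then the index $[M:N]$ is the scalar with $\sum_i\lambda_i^*\lambda_i=[M:N]1$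 (independent of the basis). The normaliser is $\mathcal{N}_M(N)=\{u\in M\text{ unitary}:u^*Nu=N\}$. A quantum graph is a triple $(\mathcal{S},R,\mathcal{B}(H))$ with $R\subseteq\mathcal{B}(H)$ a von Neumann algebra and $\mathcal{S}\subseteq\mathcal{B}(H)$ a weak* closed operator system which is an $R'$-bimodule. For $H$ finite-dimensional, $L$ a tracial von Neumann algebra and $c\in\mathbb{N}$, it is $(L,c)$ colourable if there is a projection-valued measure $\{P_a\}_{a=1}^c$ in $R\otimes L$ (projections summing to $1$) with $$P_a\big((\mathcal{S}\cap(R')^\perp)\otimes1_L\big)P_a=0,\qquad a=1,\dots,c,$$ where $(R')^\perp$ is the orthogonal complement of $R'$ in $\mathcal{B}(H)$ for the trace (Hilbert--Schmidt) inner product. $\chi_{qc}$ (quantum commuting chromatic number), $\chi_q$ (quantum chromatic number) and $\chi_{loc}$ (local chromatic number) of $(\mathcal{S},R,\mathcal{B}(H))$ are the least $c$ such that it is $(L,c)$ colourable for, respectively, some tracial von Neumann algebra $L$, some finite-dimensional $L$, and $L=\mathbb{C}$. Here $\mathcal{S}=M$, $R=N'$, $R'=N$, $H=L^2(M,\tau)$. *)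

(* Defs.v *)
From HB Require Import structures.
From mathcomp Require Import all_boot all_order all_algebra falgebra.
From mathcomp Require Import ring.
From mathcomp Require Import sesquilinear complex.
From mathcomp Require Import boolp classical_sets reals constructive_ereal ereal.

Set Implicit Arguments.
Unset Strict Implicit.
Unset Printing Implicit Defensive.
Import Order.TTheory GRing.Theory Num.Theory Num.Def.
Local Open Scope classical_set_scope.
Local Open Scope ring_scope.

Record involution (R : realType) (A : algType R[i]) := Involution {
  star :> A -> A;
  starD : forall x y, star (x + y) = star x + star y;
  starZ : forall a x, star (a *: x) = conjC a *: star x;
  starM : forall x y, star (x * y) = star y * star x;
  starK : forall x, star (star x) = x
}.

(* Inner products are linear in the first variable. *)
Record hilbert (R : realType) := Hilbert {
  hvec :> lmodType R[i];
  hdot : {dot hvec for conjC};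
  hcomplete : forall v : nat -> hvec,
    (forall eps : R[i], 0 < eps -> exists n, forall i j, (n <= i)%N ->
       (n <= j)%N -> hdot (v i - v j) (v i - v j) < eps) ->
    exists l : hvec, forall eps : R[i], 0 < eps -> exists n, forall i,
       (n <= i)%N -> hdot (v i - l) (v i - l) < eps
}.

Section VonNeumannAlgebras.
Variable R : realType.
Local Notation C := R[i].

Section Operators.
Variable K : hilbert R.

Definition bounded_operators : set (K -> K) :=
  [set T | linear T /\
     exists k : C, forall x, hdot K (T x) (T x) <= k * hdot K x x].

Definition bcommutant (S : set (K -> K)) : set (K -> K) :=
  [set T | bounded_operators T /\ forall s, S s -> T \o s = s \o T].

Definition is_adjoint (T T' : K -> K) :=
  forall x y, hdot K (T x) y = hdot K x (T' y).

Definition von_neumann_on (S : set (K -> K)) :=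
  [/\ S `<=` bounded_operators,
      forall T, S T -> exists2 T', S T' & is_adjoint T T'
    & bcommutant (bcommutant S) = S].

End Operators.

Section Algebras.
Variables (A : algType C) (st : involution A).

Definition faithful_star_rep (K : hilbert R) (pi : A -> K -> K) :=
  [/\ (forall a, bounded_operators (pi a))
        /\ (forall c a b x, pi (c *: a + b) x = c *: pi a x + pi b x),
      pi 1 = id,
      forall a b, pi (a * b) = pi a \o pi b,
      forall a, is_adjoint (pi a) (pi (st a))
    & injective pi].

Definition is_vNA :=
  exists (K : hilbert R) (pi : A -> K -> K),
    faithful_star_rep pi /\ von_neumann_on (range pi).

(* The C*-order: positive elements are those of the form z^* z. *)
Definition star_le (x y : A) := exists z, y - x = st z * z.

Definition directed (D : set A) :=
  D !=set0 /\ forall x y, D x -> D y ->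
    exists z, [/\ D z, star_le x z & star_le y z].

Definition is_lub (D : set A) (s : A) :=
  (forall x, D x -> star_le x s)
  /\ forall t, (forall x, D x -> star_le x t) -> star_le s t.

Definition normal_functional (f : A -> C) :=
  forall (D : set A) (s : A),
    (forall x, D x -> star_le 0 x) -> directed D -> is_lub D s ->
    forall r : C, (forall x, D x -> f x <= r) -> f s <= r.

Record faithful_trace := FaithfulTrace {
  tau_fun :> {scalar A};
  tau1 : tau_fun 1 = 1;
  tauC : forall x y, tau_fun (x * y) = tau_fun (y * x);
  tau_ge0 : forall x, 0 <= tau_fun (st x * x);
  tau_faithful : forall x, tau_fun (st x * x) = 0 -> x = 0;
  tau_normal : normal_functional tau_fun
}.

(* The inner product of L^2(A, tau), on the image of the GNS map. *)
Definition l2dot (tau : faithful_trace) (x y : A) : C := tau (st y * x).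

End Algebras.

Section L2.
Variables (A : algType C) (st : involution A) (tau : faithful_trace st).

Lemma l2dot_linear_l y : linear_for *%R ((l2dot tau)^~ y).
Proof. by move=> a u v; rewrite /l2dot mulrDr -scalerAr linearP. Qed.

Lemma l2dot_linear_r x : linear_for (conjC \; *%R) (l2dot tau x).
Proof.
by move=> a u v; rewrite /l2dot starD starZ mulrDl -scalerAl linearP.
Qed.

HB.instance Definition _ :=
  bilinear_isBilinear.Build C A A C *%R (conjC \; *%R) (l2dot tau)
    (l2dot_linear_l, l2dot_linear_r).

Lemma l2dot_herm x y :
  l2dot tau x y = (-1) ^+ false * conjC (l2dot tau y x).
Proof.
rewrite expr0 mul1r.
have qreal z : conjC (l2dot tau z z) = l2dot tau z z.
  by apply: conj_Creal; apply: ger0_real; exact: tau_ge0.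
have h1 := qreal (x + y); have h2 := qreal (x + 'i *: y).
move: h1 h2.
rewrite !(linearDl, linearDr) /= !(linearZl_LR, linearZr_LR) /=.
rewrite !rmorphD !rmorphM /= !qreal !conjCK conjCi.
set a := l2dot tau x y; set b := l2dot tau y x.
set p := l2dot tau x x; set q := l2dot tau y y => h1 h2.
have e1 : conjC a + conjC b = a + b.
  have /eqP := h1; rewrite -subr_eq0 => /eqP h; apply/eqP; rewrite -subr_eq0.
  by apply/eqP; rewrite -[RHS]h; ring.
have e2 : conjC a - conjC b = b - a.
  have /eqP := h2; rewrite -subr_eq0 => /eqP h; apply: (mulfI (neq0Ci C)).
  by apply/eqP; rewrite -subr_eq0; apply/eqP; rewrite -[RHS]h; ring.
have e3 : 2%:R * a = 2%:R * conjC b.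
  have -> : 2%:R * a = (a + b) - (b - a) by ring.
  by rewrite -e1 -e2; ring.
by apply: (mulfI _ e3); rewrite pnatr_eq0.
Qed.

HB.instance Definition _ :=
  isHermitianSesquilinear.Build C A false conjC (l2dot tau) l2dot_herm.

Lemma l2dot_gt0 x : x != 0 -> 0 < l2dot tau x x.
Proof.
move=> x0; rewrite lt_def tau_ge0 andbT.
by apply: contra_neq x0; exact: tau_faithful.
Qed.

HB.instance Definition _ :=
  isDotProduct.Build C A (l2dot tau) l2dot_gt0.
End L2.

Section FiniteDimensionalHilbertSpaces.
Variables (H : vectType C) (dot : {dot H for conjC}).

Definition commutant (S : set 'End(H)) : set 'End(H) :=
  [set T | forall s, S s -> (T \o s)%VF = (s \o T)%VF].

Definition lfun_adjoint (T T' : 'End(H)) :=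
  forall x y, dot (T x) y = dot x (T' y).

Section Basis.
(* To be used with an orthonormal basis e of H. *)
Variable e : (\dim {:H}).-tuple H.

Definition hs_dot (X Y : 'End(H)) : C :=
  \sum_i dot (X (tnth e i)) (Y (tnth e i)).

Definition hs_orth (S : set 'End(H)) : set 'End(H) :=
  [set X | forall Y, S Y -> hs_dot X Y = 0].

(* B(H) (x) L is identified with M_n(L), n = dim H, through e. As B(H) is
   finite-dimensional, the von Neumann tensor product of a subalgebra of B(H)
   with L is the algebraic one. *)
Section Tensor.
Variables (L : algType C) (st : involution L).

Definition tens (T : 'End(H)) (a : L) : 'M[L]_(\dim {:H}) :=
  \matrix_(i, j) (dot (T (tnth e j)) (tnth e i) *: a).

Definition in_tensor (V : set 'End(H)) (P : 'M[L]_(\dim {:H})) :=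
  exists s : seq ('End(H) * L),
    (forall p, p \in s -> V p.1) /\ P = \sum_(p <- s) tens p.1 p.2.

Definition is_projection (P : 'M[L]_(\dim {:H})) :=
  P *m P = P /\ map_mx st P^T = P.

End Tensor.
End Basis.

(* Colourability of the quantum graph (S, V, B(H)). The choice of e is
   immaterial. *)
Definition colourable (L : algType C) (st : involution L)
    (S V : set 'End(H)) (c : nat) :=
  exists e : (\dim {:H}).-tuple H, orthonormal dot e /\
  exists P : 'I_c -> 'M[L]_(\dim {:H}),
    [/\ forall a, in_tensor e V (P a),
        forall a, is_projection st (P a),
        \sum_a P a = 1%:M
      & forall a X, S X -> hs_orth e (commutant V) X ->
          P a *m tens e X 1 *m P a = 0].

Lemma conjC_starZ (a : C) (x : C^o) : conjC (a *: x) = conjC a *: conjC x :> C^o.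
Proof. exact: rmorphM. Qed.

Lemma conjC_starM (x y : C^o) : conjC (x * y) = conjC y * conjC x :> C^o.
Proof. by rewrite rmorphM mulrC. Qed.

Definition conj_involution : involution C^o :=
  @Involution R C^o conjC (rmorphD conjC) conjC_starZ conjC_starM (@conjCK C).

(* ereal_inf is the least element of a nonempty set of naturals; it is +oo on
   the empty set. *)
Definition least (Q : set nat) : \bar R := ereal_inf [set (c%:R)%:E | c in Q].

Definition chi_loc (S V : set 'End(H)) :=
  least (colourable conj_involution S V).

Definition chi_q (S V : set 'End(H)) :=
  least [set c | exists (L : falgType C) (st : involution L)
                        (_ : faithful_trace st),
                   is_vNA st /\ colourable st S V c].

Definition chi_qc (S V : set 'End(H)) :=
  least [set c | exists (L : algType C) (st : involution L)
                        (_ : faithful_trace st),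
                   is_vNA st /\ colourable st S V c].

End FiniteDimensionalHilbertSpaces.

(* For finite-dimensional M the GNS map is bijective, so L^2(M, tau) is M itself
   with the inner product l2dot tau, and x in M acts on it as amull x. *)
Section Inclusions.
Variables (M : falgType C) (st : involution M) (tau : faithful_trace st).
Variable N : {aspace M}.

Definition vN_inclusion :=
  1 \in N /\
  exists (K : hilbert R) (pi : M -> K -> K),
    [/\ faithful_star_rep st pi,
        von_neumann_on (range pi)
      & von_neumann_on (pi @` [set x | x \in N])].

Definition left_mul (V : {vspace M}) : set 'End(M) :=
  [set amull x | x in [set x | x \in V]].

(* jones_proj is e_N and cond_exp is E_N. The properties in cond_exp determine
   E_N; its positivity is automatic. Both always exist, so the default value of
   xget is not taken. *)
Definition jones_proj : 'End(M) := xget 0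
  [set p : 'End(M) | forall x, p x \in N /\
                       forall y, y \in N -> l2dot tau (x - p x) y = 0].

Definition cond_exp : 'End(M) := xget 0
  [set E : 'End(M) |
    [/\ forall x, E x \in N,
        forall x, x \in N -> E x = x,
        forall a x b, a \in N -> b \in N -> E (a * x * b) = a * E x * b
      & forall x, tau (E x) = tau x]].

Definition pp_basis (s : seq M) :=
  uniq s /\ \sum_(l <- s) (amull (st l) \o jones_proj \o amull l)%VF = \1%VF.

Definition pp_orthonormal (s : seq M) :=
  forall l m, l \in s -> m \in s -> cond_exp (l * st m) = (l == m)%:R.

Definition basic_construction : set 'End(M) :=
  commutant (commutant (left_mul {:M} `|` [set jones_proj])).

(* tr_1 on M_1 = basic_construction, extended arbitrarily to B(L^2(M, tau)).
   It is finite because M_1 is finite-dimensional. *)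
Definition canonical_trace (tr1 : {scalar 'End(M)}) :=
  [/\ forall S T, basic_construction S -> basic_construction T ->
        tr1 (S \o T)%VF = tr1 (T \o S)%VF,
      forall T T', basic_construction T -> lfun_adjoint (l2dot tau) T T' ->
        0 <= tr1 (T' \o T)%VF
    & forall x y, tr1 (amull x \o jones_proj \o amull y)%VF = tau (x * y)].

Definition markov :=
  exists tr1 : {scalar 'End(M)}, canonical_trace tr1 /\
    forall x, (tr1 \1%VF)^-1 * tr1 (amull x) = tau x.

Definition strongly_markov := markov /\ exists s, pp_basis s.

Definition jones_index : R := xget 0
  [set r | exists2 s, pp_basis s & \sum_(l <- s) st l * l = (r%:C)%C%:A].

Definition normaliser (v : M) :=
  [/\ st v * v = 1, v * st v = 1
    & [set st v * y * v | y in [set x | x \in N]] = [set x | x \in N]].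

End Inclusions.
End VonNeumannAlgebras.

(* Main.v *)
From HB Require Import structures.
Require Import Defs.
From mathcomp Require Import all_boot all_order all_algebra falgebra.
From mathcomp Require Import sesquilinear complex.
From mathcomp Require Import boolp classical_sets reals constructive_ereal ereal.

Set Implicit Arguments.
Unset Strict Implicit.
Unset Printing Implicit Defensive.
Import Order.TTheory GRing.Theory Num.Theory Num.Def.
Local Open Scope ring_scope.

(** Let d be the number of elements of the orthonormal basis [us]. Since the
    u in [us] are unitaries, the sum of the u^* u is d, so the index is d; the
    Markov trace, evaluated at 1 = sum_l l^* e_N l, shows that any other basis
    gives the same scalar ([jones_index_size]).

    Upper bound. As u normalises N, the projection p_u = u^* e_N u commutes
    with N, and E_N (u x u^* ) = u E_N(x) u^* gives p_u x p_u = E_N(x) p_u for x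
    in M. The p_u sum to 1, so they colour the graph with d colours over the
    complex numbers as soon as the x in M orthogonal to N'' = (N')' are those
    with E_N(x) = 0. That orthogonality refers to the trace of B(L^2 M), whose
    restriction to M need not be tau; the p_u themselves settle the matter.
    If E_N(x) = 0 then every p_u x p_u vanishes, and Y in N'' commutes with the
    p_u, hence Tr(Y^* x) = sum_u Tr(Y^* p_u x p_u) = 0 ([hs_dot_pinched0]).
    Conversely, if x is orthogonal to N'', so is E_N(x) by the first case
    applied to x - E_N(x); but E_N(x) lies in N'', so it is 0
    ([hs_orth_jones_proj0], [normaliser_colouring]).

    Lower bound. For u <> v in [us], E_N(u v^* ) = 0, so a colouring (P_a) over
    a tracial algebra L satisfies P_a u v^* P_a = 0. Therefore u^* P_a u and
    v^* P_a v are orthogonal projections, and their sum Q_a over [us] is a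
    projection. The Q_a add up to sum_u u^* u = d, while each is at most 1, and
    comparing traces gives d <= c ([colourable_ge]).

    All three chromatic numbers are minima over classes of algebras that contain
    the complex numbers and consist of algebras with a faithful trace, so each
    of them equals d. *)

(** * Inner products *)

Section DotProducts.
Variables (R : realType) (U : lmodType R[i]) (dot : {dot U for conjC}).

Lemma dotC x y : dot x y = conjC (dot y x).
Proof. by rewrite hermC expr0 mul1r. Qed.

Lemma dot0l y : dot 0 y = 0. Proof. exact: linear0l. Qed.

Lemma dotBl x y z : dot (x - y) z = dot x z - dot y z.
Proof. exact: linearBl. Qed.

Lemma dotZl a x y : dot (a *: x) y = a * dot x y.
Proof. exact: linearZl_LR. Qed.

Lemma dotZr a x y : dot x (a *: y) = conjC a * dot x y.
Proof. exact: linearZr_LR. Qed.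

Lemma dot_suml I (s : seq I) (P : pred I) (F : I -> U) y :
  dot (\sum_(i <- s | P i) F i) y = \sum_(i <- s | P i) dot (F i) y.
Proof. exact: linear_sumlz. Qed.

Lemma dot_sumr I (s : seq I) (P : pred I) (F : I -> U) x :
  dot x (\sum_(i <- s | P i) F i) = \sum_(i <- s | P i) dot x (F i).
Proof. exact: linear_sumr. Qed.

Lemma dot_ext x y : (forall z, dot x z = dot y z) -> x = y.
Proof.
move=> xy; apply/eqP; rewrite -subr_eq0 -(dnorm_eq0 dot).
by rewrite dotBl xy subrr.
Qed.

Lemma cauchy_schwarz x y : `|dot x y| ^+ 2 <= dot x x * dot y y.
Proof.
have [->|y0] := eqVneq y 0.
  by rewrite [dot x 0]dotC !dot0l conjC0 normr0 expr0n mulr0.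
have dy : dot y y != 0 by rewrite dnorm_eq0.
pose a := dot x y / dot y y; pose z := x - a *: y.
have zy : dot (a *: y) z = 0.
  by rewrite dotZl dotC /z dotBl dotZl /a divfK // subrr conjC0 mulr0.
have -> : dot x y = a * dot y y by rewrite /a divfK.
have -> : x = a *: y + z by rewrite /z addrC subrK.
have -> : dot (a *: y + z) (a *: y + z) = `|a| ^+ 2 * dot y y + dot z z.
  by rewrite hnormDd //= dnormZ.
rewrite mulrDl normrM exprMn [`|dot y y|]ger0_norm ?dnorm_ge0 //.
by rewrite expr2 mulrA lerDl mulr_ge0 ?dnorm_ge0.
Qed.

End DotProducts.

(** * Orthonormal bases and the Hilbert-Schmidt inner product *)

Section OrthonormalBases.
Variables (R : realType) (H : vectType R[i]) (dot : {dot H for conjC}).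

(** Gram-Schmidt: as long as the family does not span, the component orthogonal
    to it of some vector can be normalised and added. *)
Lemma exists_orthonormal_seq k : (k <= \dim {:H})%N ->
  exists2 s : seq H, size s = k & orthonormal dot s.
Proof.
elim: k => [|k IHk] lekd; first by exists [::].
have [s szs os] := IHk (ltnW lekd).
have [v vNs] : exists v, v \notin <<s>>%VS.
  apply: contrapT => nv; move: lekd; rewrite ltnNge -szs => /negP; apply.
  apply: leq_trans (dim_span s); apply: dimvS; apply/subvP => x _.
  by apply/negPn/negP => xNs; apply: nv; exists x.
have [x xs [y [vE _ ys]]] := orthogonal_split dot s v.
have y0 : y != 0.
  by apply: contraNneq vNs => y0; rewrite vE y0 addr0.
have dy0 : sqrtC (dot y y) != 0 by rewrite sqrt_dnorm_eq0.
exists ((sqrtC (dot y y))^-1 *: y :: s); first by rewrite /= szs.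
rewrite -cat1s orthonormal_cat os /=.
apply/andP; split.
  rewrite /orthonormal /= !andbT; apply/eqP.
  rewrite dnormZ normfV exprVn ger0_norm ?sqrt_dnorm_ge0 // sqrtCK mulVf //.
  by rewrite dnorm_eq0.
rewrite andbT; apply/allP => u us /=; rewrite dotZl.
by move: ys; rewrite /orthogonal /= andbT => /allP /(_ u us) /eqP ->;
  rewrite mulr0.
Qed.

Lemma exists_orthonormal_basis :
  exists e : (\dim {:H}).-tuple H, orthonormal dot e.
Proof.
have [s /eqP szs os] := exists_orthonormal_seq (leqnn _).
by exists (Tuple szs).
Qed.

Variable e : (\dim {:H}).-tuple H.
Hypothesis oe : orthonormal dot e.

Lemma dot_basis i j : dot (tnth e i) (tnth e j) = (i == j)%:R.
Proof.
have [/tuple_uniqP ue ->] := orthonormalP oe; rewrite ?mem_tnth //.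
by rewrite (inj_eq ue).
Qed.

Lemma basis_expansion x : x = \sum_i dot x (tnth e i) *: tnth e i.
Proof.
have be : basis_of {:H} e.
  by rewrite basisEfree (orthonormal_free oe) subvf size_tuple leqnn.
have [c ->] : exists c : 'I_(\dim {:H}) -> R[i], x = \sum_i c i *: tnth e i.
  exists (coord e ^~ x); rewrite {1}(coord_basis be (memvf x)).
  by apply: eq_bigr => i _; rewrite (tnth_nth 0).
apply: eq_bigr => i _; congr (_ *: _).
rewrite dot_suml (bigD1 i) //= dotZl dot_basis eqxx mulr1.
rewrite big1 ?addr0 // => j ji.
by rewrite dotZl dot_basis (negPf ji) mulr0.
Qed.

Section HilbertSchmidt.

Lemma hs_dot_shiftl P X Y : lfun_adjoint dot P P ->
  hs_dot dot e (P \o X)%VF Y = hs_dot dot e X (P \o Y)%VF.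
Proof. by move=> Psa; apply: eq_bigr => i _; rewrite !comp_lfunE Psa. Qed.

(** Cyclicity of the trace: Tr(Y^* X P) = Tr(P Y^* X), where P Y^* = (Y P)^*
    as P is self-adjoint. *)
Lemma hs_dot_shiftr P X Y : lfun_adjoint dot P P ->
  hs_dot dot e (X \o P)%VF Y = hs_dot dot e X (Y \o P)%VF.
Proof.
move=> Psa; rewrite /hs_dot.
under eq_bigr => i _.
  rewrite comp_lfunE (basis_expansion (P (tnth e i))) linear_sum dot_suml.
  under eq_bigr => j _ do rewrite linearZ /= dotZl.
  over.
rewrite exchange_big; apply: eq_bigr => j _ /=.
rewrite comp_lfunE (basis_expansion (P (tnth e j))) linear_sum dot_sumr.
apply: eq_bigr => i _; rewrite linearZ /= dotZr.
by rewrite Psa dotC.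
Qed.

Lemma hs_dotBl X Y Z :
  hs_dot dot e (X - Y) Z = hs_dot dot e X Z - hs_dot dot e Y Z.
Proof.
by rewrite -sumrB; apply: eq_bigr => i _; rewrite add_lfunE opp_lfunE dotBl.
Qed.

(** With P_k the given projections, Y commutes with them, so
    Tr(Y^* X) = sum_k Tr(Y^* X P_k) = sum_k Tr(Y^* P_k X P_k). This replaces any
    computation of the trace of B(H) on a subalgebra. *)
Lemma hs_dot_pinched0 (I : eqType) (s : seq I) (p : I -> 'End(H)) X Y :
    \sum_(k <- s) p k = \1%VF ->
    {in s, forall k, [/\ (p k \o p k)%VF = p k, lfun_adjoint dot (p k) (p k),
       (p k \o X \o p k)%VF = 0 & (Y \o p k)%VF = (p k \o Y)%VF]} ->
  hs_dot dot e X Y = 0.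
Proof.
move=> p1 pP; have -> : X = \sum_(k <- s) (X \o p k)%VF.
  apply/lfunP => x; rewrite sum_lfunE -{1}[x](id_lfunE x) -p1 sum_lfunE.
  by rewrite linear_sum; apply: eq_bigr => k _; rewrite comp_lfunE.
rewrite /hs_dot.
under eq_bigr do rewrite sum_lfunE dot_suml.
rewrite exchange_big big_seq big1 // => k ks.
have [pp psa pXp Yp] := pP k ks.
change (hs_dot dot e (X \o p k)%VF Y = 0).
rewrite -pp comp_lfunA hs_dot_shiftr // Yp -hs_dot_shiftl // comp_lfunA pXp.
by rewrite /hs_dot big1 // => i _; rewrite lfunE dot0l.
Qed.

Lemma hs_dot_definite X : hs_dot dot e X X = 0 -> X = 0.
Proof.
move=> /eqP; rewrite psumr_eq0 => [/allP X0|i _]; last exact: dnorm_ge0.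
apply/lfunP => x; rewrite lfunE (basis_expansion x) linear_sum big1 // => i _.
have := X0 i (mem_index_enum _); rewrite dnorm_eq0 => /eqP Xi.
by rewrite linearZ /= Xi scaler0.
Qed.

End HilbertSchmidt.

(** * Operators as matrices over an involutive algebra *)

Section Tensors.
Variables (L : algType R[i]) (st : involution L).
Local Notation tens := (@tens R H dot e L).

Lemma star0 : st 0 = 0.
Proof. by rewrite -[0 in LHS](scale0r 0) starZ conjC0 scale0r. Qed.

Lemma star1 : st 1 = 1.
Proof. by rewrite -[RHS](starK st) -[st 1 in RHS]mulr1 starM starK mulr1. Qed.

Lemma star_sum I (r : seq I) (P : pred I) (F : I -> L) :
  st (\sum_(i <- r | P i) F i) = \sum_(i <- r | P i) st (F i).
Proof. exact: (big_morph _ (starD st) star0). Qed.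

Lemma tens_comp S T a b : tens S a *m tens T b = tens (S \o T)%VF (a * b).
Proof.
apply/matrixP => i j; rewrite !mxE comp_lfunE.
rewrite [in RHS](basis_expansion (T _)) linear_sum dot_suml scaler_suml.
apply: eq_bigr => k _; rewrite !mxE linearZ dotZl.
by rewrite -scalerAl -scalerAr scalerA mulrC.
Qed.

Lemma tens_id : tens \1%VF 1 = 1%:M.
Proof.
by apply/matrixP => i j; rewrite !mxE lfunE dot_basis eq_sym scaler_nat.
Qed.

Lemma tens_suml I (s : seq I) (F : I -> 'End(H)) a :
  tens (\sum_(i <- s) F i) a = \sum_(i <- s) tens (F i) a.
Proof.
apply/matrixP => i j; rewrite !mxE sum_lfunE dot_suml scaler_suml summxE.
by apply: eq_bigr => k _; rewrite mxE.
Qed.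

Lemma tens0l a : tens 0 a = 0.
Proof. by apply/matrixP => i j; rewrite !mxE lfunE dot0l scale0r. Qed.

Local Notation "A ^*mx" := (map_mx st A^T) (at level 2).

Lemma adjmx_tens T T' a :
  lfun_adjoint dot T T' -> (tens T a)^*mx = tens T' (st a).
Proof.
by move=> TT'; apply/matrixP => i j; rewrite !mxE starZ TT' dotC conjCK.
Qed.

Lemma adjmxM m n p (A : 'M[L]_(m, n)) (B : 'M[L]_(n, p)) :
  (A *m B)^*mx = B^*mx *m A^*mx.
Proof.
apply/matrixP => i j; rewrite !mxE star_sum.
by apply: eq_bigr => k _; rewrite !mxE starM.
Qed.

Lemma adjmx_sum m n I (s : seq I) (F : I -> 'M[L]_(m, n)) :
  (\sum_(i <- s) F i)^*mx = \sum_(i <- s) (F i)^*mx.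
Proof.
apply/matrixP => i j; rewrite !mxE !summxE star_sum.
by apply: eq_bigr => k _; rewrite !mxE.
Qed.

Lemma adjmx1 n : (1%:M : 'M[L]_n)^*mx = 1%:M.
Proof.
by apply/matrixP => i j; rewrite !mxE eq_sym; case: eqP; rewrite ?star1 ?star0.
Qed.

Lemma trace_adjmx_mul_ge0 (tau : faithful_trace st) m n (A : 'M[L]_(m, n)) :
  0 <= tau (\tr (A^*mx *m A)).
Proof.
rewrite /mxtrace linear_sum; apply: sumr_ge0 => i _; rewrite mxE linear_sum.
by apply: sumr_ge0 => j _; rewrite !mxE tau_ge0.
Qed.

End Tensors.
End OrthonormalBases.

(** * A lower bound for the number of colours *)

Section LowerBound.
Variables (R : realType) (L : algType R[i]) (st : involution L).
Variable tau : faithful_trace st.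

Lemma adjmxB m n (A B : 'M[L]_(m, n)) :
  map_mx st (A - B)^T = map_mx st A^T - map_mx st B^T.
Proof.
apply/matrixP => i j; rewrite !mxE starD.
by rewrite -[in LHS]scaleN1r starZ conjCN1 scaleN1r.
Qed.

(** Each 1 - Q_a is again a projection, so its trace is nonnegative; these
    traces add up to (c - d) n. *)
Lemma projections_sum_le n c d (Q : 'I_c -> 'M[L]_n) : (0 < n)%N ->
  (forall a, Q a *m Q a = Q a /\ map_mx st (Q a)^T = Q a) ->
  \sum_a Q a = d%:R%:M -> (d <= c)%N.
Proof.
move=> n0 Qproj sumQ.
have : 0 <= \sum_a tau (\tr (map_mx st (1%:M - Q a)^T *m (1%:M - Q a))).
  by apply: sumr_ge0 => a _; exact: trace_adjmx_mul_ge0.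
rewrite (eq_bigr (fun a => tau (\tr (1%:M - Q a)))) => [|a _]; last first.
  have [QQ Qsa] := Qproj a.
  by rewrite adjmxB adjmx1 Qsa mulmxBr mulmx1 mulmxBl mul1mx QQ subrr subr0.
rewrite -!raddf_sum /= sumrB sumQ sumr_const card_ord.
rewrite -[1%:M *+ c](raddfMn (@scalar_mx _ n)) -raddfB /= mxtrace_scalar.
have tauE k : tau k%:R = k%:R by rewrite raddfMn /= tau1.
by rewrite raddfMn raddfB /= !tauE pmulrn_lge0 // subr_ge0 ler_nat.
Qed.

End LowerBound.

Section ColouringLowerBound.
Variables (R : realType) (H : vectType R[i]) (dot : {dot H for conjC}).
Variables (L : algType R[i]) (st : involution L) (tau : faithful_trace st).
Variables (S V : set 'End(H)) (d : nat) (U U' : 'I_d -> 'End(H)).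

(** For a colour a, the compressions U_i^* P_a U_i are mutually orthogonal
    because P_a U_i U_j^* P_a = 0, so they add up to a projection; over all
    colours these projections sum to d. *)
Lemma colourable_ge c :
    (0 < \dim {:H})%N ->
    (forall i, lfun_adjoint dot (U i) (U' i)) ->
    (forall i, (U i \o U' i)%VF = \1%VF) ->
    (forall i, (U' i \o U i)%VF = \1%VF) ->
    (forall i j, i != j -> S (U i \o U' j)%VF) ->
    (forall e : (\dim {:H}).-tuple H, orthonormal dot e -> forall i j, i != j ->
       hs_orth dot e (commutant V) (U i \o U' j)%VF) ->
  colourable dot st S V c -> (d <= c)%N.
Proof.
move=> H0 Uadj UU' U'U SU orthU [e [oe [P [_ Pproj sumP Pcol]]]].
pose u i := tens dot e (U i) (1 : L); pose v i := tens dot e (U' i) (1 : L).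
have uv i : u i *m v i = 1%:M by rewrite tens_comp // mulr1 UU' tens_id.
have vu i : v i *m u i = 1%:M by rewrite tens_comp // mulr1 U'U tens_id.
have uadj i : map_mx st (u i)^T = v i.
  by rewrite (adjmx_tens _ _ _ (Uadj i)) star1.
have vadj i : map_mx st (v i)^T = u i.
  by rewrite -uadj; apply/matrixP => k l; rewrite !mxE starK.
have Puv a i j : i != j -> P a *m u i *m v j *m P a = 0.
  move=> ij; rewrite -[P a *m _ *m _]mulmxA tens_comp // mulr1.
  by apply: Pcol; [exact: SU | exact: orthU].
pose Q a := \sum_i v i *m P a *m u i.
apply: (projections_sum_le tau H0 (Q := Q)) => [a|].
  have [PP Psa] := Pproj a; split.
    rewrite /Q mulmx_suml; apply: eq_bigr => i _.
    rewrite mulmx_sumr (bigD1 i) //= big1 ?addr0 => [|j ji].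
      rewrite !mulmxA -[_ *m u i *m v i]mulmxA uv mulmx1.
      by rewrite -[_ *m P a *m P a]mulmxA PP.
    rewrite !mulmxA -(mulmxA (v i)) -(mulmxA (v i)) -(mulmxA (v i)).
    by rewrite Puv 1?eq_sym // mulmx0 mul0mx.
  rewrite /Q adjmx_sum; apply: eq_bigr => i _.
  by rewrite !adjmxM Psa uadj vadj mulmxA.
rewrite exchange_big /=.
under eq_bigr do rewrite -mulmx_suml -mulmx_sumr sumP mulmx1 vu.
by rewrite sumr_const card_ord -[_ *+ d](raddfMn (@scalar_mx _ _)).
Qed.

End ColouringLowerBound.

(** * The Jones projection and the normaliser *)

Section ConditionalExpectation.
Variables (R : realType) (M : falgType R[i]) (st : involution M).
Variables (tau : faithful_trace st) (N : {aspace M}).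

Local Notation dot := (l2dot tau).
Local Notation e := (jones_proj tau N).

(** The image of N is closed under adjoints, adjoints are unique, and the
    representation is faithful. *)
Lemma vN_inclusion_star x : vN_inclusion st N -> x \in N -> st x \in N.
Proof.
move=> [_ [K [pi [[_ _ _ piA piI] _ [_ adjN _]]]]] xN.
have [T' [y yN <-] xy] : exists2 T',
      [set pi z | z in [set x | x \in N]]%classic T'
    & is_adjoint (pi x) T' by apply: adjN; exists x.
suff -> : st x = y by [].
apply: piI; apply/funext => w; apply: (@dot_ext _ _ (hdot K)) => z.
by rewrite dotC -piA xy -dotC.
Qed.

Lemma l2dot_mull a x y : dot (a * x) y = dot x (st a * y).
Proof. by rewrite /l2dot starM starK !mulrA. Qed.

Lemma l2dot_mulr a x y : dot (x * a) y = dot x (y * st a).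
Proof. by rewrite /l2dot starM starK mulrA tauC !mulrA. Qed.

Lemma amullE (a x : M) : amull a x = a * x.
Proof. by rewrite lfunE. Qed.

Lemma l2dot_adj_amull a : lfun_adjoint dot (amull a) (amull (st a)).
Proof. by move=> x y; rewrite !lfunE /= l2dot_mull. Qed.

Hypothesis N1 : 1 \in N.
Hypothesis starN : forall x, x \in N -> st x \in N.

(* On M = L^2(M, tau) the Jones projection and the conditional expectation are
   the same map; the properties of E_N are derived from those of e_N. *)
Hypothesis eP : forall x, e x \in N /\ forall y, y \in N -> dot (x - e x) y = 0.

Lemma jones_proj_mem x : e x \in N. Proof. by have [] := eP x. Qed.

Lemma jones_projE x y :
  y \in N -> (forall n, n \in N -> dot (x - y) n = 0) -> e x = y.
Proof.
move=> yN xy; have [exN xe] := eP x.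
have dN : e x - y \in N by rewrite rpredB.
apply/eqP; rewrite -subr_eq0 -(dnorm_eq0 (l2dot tau)).
have {1}-> : e x - y = (x - y) - (x - e x) by rewrite opprB [RHS]addrC subrKA.
by rewrite dotBl /= xy // xe // subrr.
Qed.

Lemma jones_proj_id x : x \in N -> e x = x.
Proof. by move=> xN; apply: jones_projE => // n _; rewrite subrr dot0l. Qed.

Lemma jones_proj_sa : lfun_adjoint dot e e.
Proof.
have ee x y : dot (e x) (e y) = dot x (e y).
  have [_ /(_ _ (jones_proj_mem y))/eqP] := eP x.
  by rewrite dotBl subr_eq0 => /eqP.
by move=> x y /=; rewrite -(ee x y) [LHS]dotC /= -(ee y x) [RHS]dotC.
Qed.

Lemma jones_proj_mull a x : a \in N -> e (a * x) = a * e x.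
Proof.
move=> aN; apply: jones_projE => [|n nN].
  by rewrite memvM ?jones_proj_mem.
rewrite -mulrBr l2dot_mull; have [_ ->] // := eP x.
by rewrite memvM ?starN.
Qed.

Lemma jones_proj_mulr a x : a \in N -> e (x * a) = e x * a.
Proof.
move=> aN; apply: jones_projE => [|n nN].
  by rewrite memvM ?jones_proj_mem.
rewrite -mulrBl l2dot_mulr; have [_ ->] // := eP x.
by rewrite memvM ?starN.
Qed.

Lemma cond_exp_jones_proj x : cond_exp tau N <> 0 -> cond_exp tau N x = e x.
Proof.
rewrite /cond_exp; case: xgetP => [E _ [EN Eid Ebi Etr] _|_ //].
rewrite (@jones_projE x (E x)) // => n nN; rewrite /l2dot -Etr.
rewrite -[_ * _]mulr1 Ebi ?starN ?N1 // linearB /=.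
by rewrite (Eid (E x)) ?EN // subrr mulr0 mul0r linear0.
Qed.

Section Normaliser.
Variable v : M.
Hypothesis vN : normaliser st N v.

Lemma normaliser_conj x : x \in N -> st v * x * v \in N.
Proof.
by have [_ _ /seteqP[sub _]] := vN => xN; apply: sub; exists x.
Qed.

Lemma normaliser_conjV x : x \in N -> v * x * st v \in N.
Proof.
have [_ vv /seteqP[_ sup]] := vN => xN; have [y yN <-] := sup x xN.
by rewrite !mulrA vv mul1r -mulrA vv mulr1.
Qed.

(** Conjugation by v preserves tau and N, hence the orthogonal projection
    onto N. *)
Lemma jones_proj_conj x : e (v * x * st v) = v * e x * st v.
Proof.
apply: jones_projE => [|n nN]; first exact/normaliser_conjV/jones_proj_mem.
rewrite -mulrBl -mulrBr l2dot_mulr l2dot_mull starK mulrA.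
by have [_ ->] // := eP x; exact: normaliser_conj.
Qed.

(** Its range is v^* N. *)
Definition conj_jones_proj := (amull (st v) \o e \o amull v)%VF.
Local Notation p := conj_jones_proj.

Lemma conj_jones_projE x : p x = st v * e (v * x).
Proof. by rewrite !comp_lfunE !lfunE. Qed.

Lemma conj_jones_proj_sa : lfun_adjoint dot p p.
Proof.
move=> x y /=; rewrite !conj_jones_projE l2dot_mull starK jones_proj_sa.
by rewrite -l2dot_mull.
Qed.

Lemma conj_jones_proj_idem : (p \o p)%VF = p.
Proof.
have [_ vv _] := vN; apply/lfunP => x; rewrite comp_lfunE !conj_jones_projE.
by rewrite mulrA vv mul1r jones_proj_id ?jones_proj_mem.
Qed.

(** For n in N, v n = (v n v^* ) v, and e_N commutes with v n v^* in N. *)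
Lemma conj_jones_proj_comm : commutant (left_mul N) p.
Proof.
have [v1 vv _] := vN => _ [n nN <-]; apply/lfunP => x.
rewrite !comp_lfunE !amullE.
have -> : v * (n * x) = (v * n * st v) * (v * x).
  by rewrite !mulrA -[_ * st v * v]mulrA v1 mulr1.
by rewrite jones_proj_mull ?normaliser_conjV // !mulrA v1 mul1r.
Qed.

(** The compression of x is E_N(x) v^* e_N v, because
    e_N (v x v^* ) e_N = v E_N(x) v^* e_N. *)
Lemma pinch_amull x : e x = 0 -> (p \o amull x \o p)%VF = 0.
Proof.
move=> ex0; apply/lfunP => y; rewrite !comp_lfunE !amullE.
rewrite !mulrA jones_proj_mulr ?jones_proj_mem // jones_proj_conj ex0.
by rewrite !(mulr0, mul0r) lfunE.
Qed.

End Normaliser.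
End ConditionalExpectation.

(** * The index and the colourings of the inclusion *)

Section Inclusion.
Variables (R : realType) (M : falgType R[i]) (st : involution M).
Variables (tau : faithful_trace st) (N : {aspace M}).

Local Notation dot := (l2dot tau).
Local Notation e := (jones_proj tau N).
Local Notation S := (left_mul {:M}).
Local Notation N' := (commutant (left_mul N)).

Lemma lfun_id_neq0 : (\1%VF : 'End(M)) <> 0.
Proof.
move/lfunP => /(_ 1); rewrite !lfunE /= => /eqP; by rewrite oner_eq0.
Qed.

(** If no orthogonal projection onto N existed, the default value 0 of [e] would
    turn the basis identity into 0 = 1. *)
Lemma jones_proj_spec s : pp_basis tau N s ->
  forall x, e x \in N /\ forall y, y \in N -> dot (x - e x) y = 0.
Proof.
move=> [_ s1]; have [ex_p|no_p] := pselect (exists p : 'End(M), forall x,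
  p x \in N /\ forall y, y \in N -> dot (x - p x) y = 0).
  exact: (xgetPex (0 : 'End(M)) ex_p).
have e0 : e = 0 by apply: xgetPN => p pP; apply: no_p; exists p.
case: lfun_id_neq0; rewrite -s1 big1 // => l _.
by rewrite e0 comp_lfun0r comp_lfun0l.
Qed.

(** The scalar is tr_1(1): apply tr_1 to sum_l l^* e_N l = 1. *)
Lemma markov_index s r s' r' : markov tau N ->
  pp_basis tau N s -> \sum_(l <- s) st l * l = r%:A ->
  pp_basis tau N s' -> \sum_(l <- s') st l * l = r'%:A -> r = r'.
Proof.
move=> [tr1 [[_ _ tr1e] _]].
have index t q : pp_basis tau N t -> \sum_(l <- t) st l * l = q%:A ->
    tr1 \1%VF = q.
  move=> [_ <-] tq; rewrite linear_sum (eq_bigr (fun l => tau (st l * l))).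
    by rewrite -linear_sum tq linearZ /= tau1 mulr1.
  by move=> l _; exact: tr1e.
by move=> sP sr s'P s'r; rewrite -(index _ _ sP sr) (index _ _ s'P s'r).
Qed.

Variable us : seq M.
Hypothesis incl : vN_inclusion st N.
Hypothesis us_basis : pp_basis tau N us.
Hypothesis us_orth : pp_orthonormal tau N us.
Hypothesis us_norm : forall v, v \in us -> normaliser st N v.

Let N1 : 1 \in N. Proof. by case: incl. Qed.
Let starN x : x \in N -> st x \in N. Proof. exact: vN_inclusion_star. Qed.
Let eP := jones_proj_spec us_basis.
Let p v := conj_jones_proj tau N v.

Lemma unitary_index : \sum_(l <- us) st l * l = (size us)%:R%:A.
Proof.
rewrite big_seq (eq_bigr (fun=> 1)) => [|l /us_norm[]//].
by rewrite -big_seq big_const_seq count_predT iter_addr_0 scaler_nat.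
Qed.

Lemma jones_index_size : markov tau N -> jones_index tau N = (size us)%:R.
Proof.
move=> mk.
have ex_r : exists r : R, exists2 s, pp_basis tau N s
    & \sum_(l <- s) st l * l = (r%:C)%C%:A.
  by exists (size us)%:R, us => //; rewrite unitary_index rmorph_nat.
have [s sP sr] := xgetPex 0 ex_r.
have := markov_index mk sP sr us_basis unitary_index.
by rewrite -(rmorph_nat (real_complex R)) => /complexI.
Qed.

(** The projections u^* e_N u pinch x to 0 and lie in N', so they commute with
    N''. *)
Lemma jones_proj0_hs_orth (f : (\dim {:M}).-tuple M) x : orthonormal dot f ->
  e x = 0 -> hs_orth dot f (commutant N') (amull x).
Proof.
move=> of_ ex0 Y YN''; have [_ us1] := us_basis.
apply: (hs_dot_pinched0 of_ us1) => v /us_norm vN; split.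
- exact: conj_jones_proj_idem.
- exact: conj_jones_proj_sa.
- exact: pinch_amull.
- by apply: YN''; exact: conj_jones_proj_comm.
Qed.

(** By the previous lemma x - E_N(x) is orthogonal to N'', hence so is E_N(x),
    which belongs to N''. *)
Lemma hs_orth_jones_proj0 (f : (\dim {:M}).-tuple M) x : orthonormal dot f ->
  hs_orth dot f (commutant N') (amull x) -> e x = 0.
Proof.
move=> of_ xorth; pose y := e x.
have yN : y \in N := jones_proj_mem eP x.
have yN'' : commutant N' (amull y) by move=> T TN'; apply/esym/TN'; exists y.
have xy0 : hs_dot dot f (amull (x - y)) (amull y) = 0.
  apply: jones_proj0_hs_orth => //.
  by rewrite linearB /= (jones_proj_id eP yN) subrr.
move: xy0; rewrite linearB hs_dotBl (xorth _ yN'') => /eqP.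
rewrite sub0r oppr_eq0 => /eqP /(hs_dot_definite of_) y0.
by rewrite -[LHS]mulr1 -[LHS]amullE y0 lfunE.
Qed.

Lemma basis_dim_gt0 : (0 < \dim {:M})%N.
Proof.
rewrite lt0n dimv_eq0; apply/negP => /eqP M0.
by have := memvf (1 : M); rewrite M0 memv0 oner_eq0.
Qed.

(** For distinct u and v in the basis, E_N(u v^* ) = 0 makes u v^* an edge
    operator, so the lower bound applies to the unitaries in [us]. *)
Lemma normaliser_colourable_ge (L : algType R[i]) (stL : involution L)
  (tauL : faithful_trace stL) c :
  colourable dot stL S N' c -> (size us <= c)%N.
Proof.
pose u i := tnth (in_tuple us) i.
have uN i : normaliser st N (u i) by apply: us_norm; exact: mem_tnth.
apply: (colourable_ge tauL (U := fun i => amull (u i))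
  (U' := fun i => amull (st (u i)))).
- exact: basis_dim_gt0.
- by move=> i; exact: l2dot_adj_amull.
- move=> i; have [_ uu _] := uN i.
  by apply/lfunP => x; rewrite comp_lfunE !amullE mulrA uu mul1r lfunE.
- move=> i; have [uu _ _] := uN i.
  by apply/lfunP => x; rewrite comp_lfunE !amullE mulrA uu mul1r lfunE.
- move=> i j _; exists (u i * st (u j)); first exact: memvf.
  by apply/lfunP => x; rewrite comp_lfunE !amullE mulrA.
move=> f of_ i j ij.
have -> : (amull (u i) \o amull (st (u j)))%VF = amull (u i * st (u j)).
  by apply/lfunP => x; rewrite comp_lfunE !amullE mulrA.
apply: jones_proj0_hs_orth => //.
(* E_N takes the value 1 at u_i u_i^*, so it is not the default value 0. *)
have E0 : cond_exp tau N <> 0.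
  have ui_us := mem_tnth i (in_tuple us).
  move=> E0; have := us_orth ui_us ui_us.
  by rewrite E0 lfunE eqxx => /esym/eqP; rewrite oner_eq0.
rewrite -cond_exp_jones_proj // us_orth ?mem_tnth //.
have /tuple_uniqP ui : uniq (in_tuple us) by case: us_basis.
by rewrite (inj_eq ui) (negPf ij).
Qed.

Lemma normaliser_colouring : colourable dot (conj_involution R) S N' (size us).
Proof.
have [f of_] := exists_orthonormal_basis dot.
exists f; split=> //.
pose q i := p (tnth (in_tuple us) i).
have uN i : normaliser st N (tnth (in_tuple us) i).
  by apply: us_norm; exact: mem_tnth.
exists (fun i => tens dot f (q i) (1 : R[i]^o)); split.
- move=> i; exists [:: (q i, 1)]; rewrite big_seq1; split=> // _ /[!inE] /eqP ->.
  exact: conj_jones_proj_comm.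
- move=> i; split; first by rewrite tens_comp // conj_jones_proj_idem // mulr1.
  rewrite (adjmx_tens _ _ _ (conj_jones_proj_sa eP _)).
  by rewrite star1.
- rewrite -(tens_id of_) -tens_suml; congr tens.
  by case: us_basis => _ <-; rewrite [RHS]big_tnth.
move=> i _ [x _ <-] /(hs_orth_jones_proj0 of_) ex0.
by rewrite !tens_comp // pinch_amull // tens0l.
Qed.

End Inclusion.

(** * The complex numbers as a tracial von Neumann algebra *)

Section ComplexNumbers.
Variable R : realType.
Local Notation C := R[i].

Lemma star_le_conjE (x y : C^o) :
  star_le (conj_involution R) x y <-> (x : C) <= y.
Proof.
split=> [[z zE]|xy].
  by rewrite -subr_ge0 zE mulrC mul_conjC_ge0.
exists (sqrtC (y - x)); rewrite /= (conj_Creal _) -?expr2 ?sqrtCK //.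
by rewrite ger0_real // sqrtC_ge0 subr_ge0.
Qed.

(** Named so that the identity carries the structure of a linear form: its
    source is scaled by *: and its target by multiplication. *)
Definition complex_scalar (x : C^o) : C := x.

Fact complex_scalar_is_linear : linear_for *%R complex_scalar.
Proof. by []. Qed.

HB.instance Definition _ :=
  GRing.isLinear.Build C C^o C *%R complex_scalar complex_scalar_is_linear.

Lemma complex_scalar_normal :
  normal_functional (conj_involution R) complex_scalar.
Proof.
move=> D s _ _ [_ sup] r Dr; apply/star_le_conjE; apply: sup => x Dx.
exact/star_le_conjE/Dr.
Qed.

Lemma complex_trace : faithful_trace (conj_involution R).
Proof.
refine (@FaithfulTrace _ _ _ complex_scalar _ _ _ _ complex_scalar_normal) => //.
- by move=> x y; rewrite /complex_scalar mulrC.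
- by move=> x; rewrite /complex_scalar mulrC mul_conjC_ge0.
by move=> x /eqP; rewrite /complex_scalar mulrC mul_conjC_eq0 => /eqP.
Qed.

Section ScalarRepresentation.
Variables (K : hilbert R) (v : K).
Hypothesis v0 : v != 0.

Definition scalar_rep (a : C^o) (x : K) : K := (a : C) *: x.

Lemma bounded_scalar a : bounded_operators (scalar_rep a).
Proof.
split=> [c x y|]; first by rewrite /scalar_rep scalerDr !scalerA mulrC.
by exists (`|a : C| ^+ 2) => x; rewrite dnormZ.
Qed.

Lemma bounded_rank_one w : bounded_operators (fun x : K => hdot K x v *: w).
Proof.
split=> [c x y|]; first by rewrite linearDl /= dotZl scalerDl scalerA.
exists (hdot K v v * hdot K w w) => x.
rewrite dnormZ [leRHS]mulrAC ler_wpM2r ?dnorm_ge0 //.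
by rewrite [leRHS]mulrC; exact: cauchy_schwarz.
Qed.

(** C acts by scalars on any nonzero Hilbert space K. The commutant of the
    scalars contains the rank one operators, and T commuting with x |-> <x, v> w
    satisfies <v, v> T w = <T v, v> w, so T is a scalar. *)
Lemma complex_is_vNA : is_vNA (conj_involution R).
Proof.
exists K, scalar_rep; split; split.
- split=> [a|c a b x]; first exact: bounded_scalar.
  by rewrite /scalar_rep scalerDl scalerA.
- by apply/funext => x; rewrite /scalar_rep scale1r.
- by move=> a b; apply/funext => x; rewrite /scalar_rep /= scalerA.
- by move=> a x y; rewrite /scalar_rep dotZl dotZr /= conjCK.
- move=> a b /funeqP /(_ v) /eqP; rewrite /scalar_rep -subr_eq0 -scalerBl.
  by rewrite scaler_eq0 (negPf v0) orbF subr_eq0 => /eqP.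
- by move=> _ [a _ <-]; exact: bounded_scalar.
- move=> _ [a _ <-]; exists (scalar_rep (conjC (a : C))).
    by exists (conjC (a : C)).
  by move=> x y; rewrite /scalar_rep dotZl dotZr conjCK.
apply/seteqP; split=> [T [[Tlin _] Tcomm]|_ [a _ <-]]; last first.
  by split=> [|T [_ Ta]]; [exact: bounded_scalar|apply/esym/Ta; exists a].
exists (hdot K (T v) v / hdot K v v) => //; apply/funext => w.
have dv : hdot K v v != 0 by rewrite dnorm_eq0.
have /Tcomm /funeqP /(_ v) /= : bcommutant (range scalar_rep)
    (fun x : K => hdot K x v *: w).
  split=> [|_ [a _ <-]]; first exact: bounded_rank_one.
  by apply/funext => x; rewrite /scalar_rep /= dotZl scalerA.
have T0 : T 0 = 0.
  by rewrite -[0 in LHS](addrN (0 : K)) -scaleN1r addrC Tlin scaleN1r addNr.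
rewrite -[_ *: w]addr0 Tlin T0 addr0 => TvE.
by rewrite /scalar_rep mulrC -scalerA -TvE scalerA mulVf // scale1r.
Qed.

End ScalarRepresentation.
End ComplexNumbers.

(** This supplies the Hilbert space on which the complex numbers act by
    scalars. *)
Lemma faithful_star_rep_neq0 (R : realType) (A : algType R[i])
    (st : involution A) (K : hilbert R) (pi : A -> K -> K) :
  faithful_star_rep st pi -> exists v : K, v != 0.
Proof.
move=> [_ _ _ _ piI]; apply: contrapT => noK; have K0 (x : K) : x = 0.
  by apply/eqP/negPn/negP => x0; apply: noK; exists x.
have /eqP := @oner_neq0 A; apply.
by apply: piI; apply/funext => x; rewrite (K0 (pi 1 x)) (K0 (pi 0 x)).
Qed.

Lemma least_eq (R : realType) (Q : set nat) d :
  Q d -> (forall c, Q c -> (d <= c)%N) -> least R Q = (d%:R)%:E.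
Proof.
move=> Qd Qge; apply/le_anti/andP; split.
  by apply: ereal_inf_lbound; exists d.
by apply: le_ereal_inf_tmp => _ [c /Qge dc <-]; rewrite lee_fin ler_nat.
Qed.

(** * The chromatic numbers *)

Theorem theorem5p8 (R : realType) (M : falgType R[i]) (st : involution M)
    (tau : faithful_trace st) (N : {aspace M}) (us : seq M)
    (hNM : vN_inclusion st N) (hmarkov : strongly_markov tau N)
    (hbasis : pp_basis tau N us) (horth : pp_orthonormal tau N us)
    (hnorm : forall v, v \in us -> normaliser st N v) :
  let S := left_mul {:M} in
  let N' := commutant (left_mul N) in
  [/\ chi_loc (l2dot tau) S N' = chi_q (l2dot tau) S N',
      chi_q (l2dot tau) S N' = chi_qc (l2dot tau) S N'
    & chi_qc (l2dot tau) S N' = (jones_index tau N)%:E].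
Proof.
move=> S N'; have [[_ [K [pi [piP _ _]]]] [mk _]] := (hNM, hmarkov).
have [v v0] := faithful_star_rep_neq0 piP.
have tauC := complex_trace R; have vnC := complex_is_vNA v0.
have colC := normaliser_colouring hNM hbasis hnorm.
have geC L stL tauL :=
  @normaliser_colourable_ge _ _ _ _ _ _ hNM hbasis horth hnorm L stL tauL.
have -> : chi_loc (l2dot tau) S N' = (size us)%:R%:E.
  by apply: least_eq => // c; exact: geC.
have -> : chi_q (l2dot tau) S N' = (size us)%:R%:E.
  apply: least_eq => [|c [L [stL [tauL [_]]]]]; last exact: geC.
  by exists R[i]^o, (conj_involution R), tauC.
have -> : chi_qc (l2dot tau) S N' = (size us)%:R%:E.
  apply: least_eq => [|c [L [stL [tauL [_]]]]]; last exact: geC.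
  by exists R[i]^o, (conj_involution R), tauC.
by rewrite (jones_index_size hbasis hnorm mk).
Qed.
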